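(* There is a radial coarsely $2$-to-1 function $f\colon X\to Y$ of proper hyperbolic spaces such that $\mathrm{asdim}(X)=1$ and $\mathrm{asdim}(Y)=2$.
   Context: For a metric space $(X,d)$ and $a,x,y\in X$ the Gromov product is $(x,y)_a=\frac12\big(d(x,a)+d(y,a)-d(x,y)\big)$. A metric space $X$ is hyperbolic if for some $\delta$ it satisfies $(x,y)_{x_0}\ge \min\{(x,z)_{x_0},(z,y)_{x_0}\}-\delta/4$ for all $x,y,z,x_0\in X$. Proper means that closed balls are compact. $f\colon X\to Y$ is large scale Lipschitz if there are $\lambda_1,\mu_1>0$ with $d(f(x),f(y))\le\lambda_1 d(x,y)+\mu_1$ for all $x,y$. It is radial (with respect to $x_0\in X$) if it is large scale Lipschitz and there are $\lambda_2,\mu_2>0$ such that for every finite geodesic $\gamma\colon[0,M]\to X$ with $\gamma(0)=x_0$, $\lambda_2 d(x,y)-\mu_2\le d(f(x),f(y))$ for all $x,y$ in the image of $\gamma$; ''radial'' means radial with respect to some point of $X$. A coarse function $f\colon X\to Y$ is coarsely $n$-to-1 if for every $R$ there is $S$ such that for each $A\subset Y$ with $\mathrm{diam}(A)<R$ one can write $f^{-1}(A)=B_1\cup\dots\cup B_n$ with $\mathrm{diam}(B_i)<S$ for all $i$. (Coarse: for every $R$ there is $S$ such that $d(x,y)<R$ implies $d(f(x),f(y))<S$, and preimages of bounded sets are bounded.) $\mathrm{asdim}$ is Gromov's asymptotic dimension. *)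

(* Defs.v *)
(* Large scale geometry over the metric spaces of MathComp-Analysis:
   [X : metricType R] has distance [mdist], and its topology is the one
   induced by [mdist]. *)
From mathcomp Require Import all_boot all_order all_algebra.
From mathcomp Require Import all_classical all_reals all_analysis.

Set Implicit Arguments.
Unset Strict Implicit.
Unset Printing Implicit Defensive.

Import Order.TTheory GRing.Theory Num.Theory.
Import numFieldNormedType.Exports.

Local Open Scope classical_set_scope.
Local Open Scope ring_scope.

Section MetricSpace.
Context {R : realType}.

Definition gromov_product (X : metricType R) (a x y : X) : R :=
  (mdist x a + mdist y a - mdist x y) / 2.

Definition hyperbolic (X : metricType R) : Prop :=
  exists delta : R, forall x y z x0 : X,
    Num.min (gromov_product x0 x z) (gromov_product x0 z y) - delta / 4
      <= gromov_product x0 x y.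

(* [closed_ball] of the library is the closure of an open ball, which in a
   general metric space is smaller than the set below. *)
Definition proper_space (X : metricType R) : Prop :=
  forall (x : X) (r : R), compact [set y | mdist x y <= r].

(* The point 0 is added so that the empty set has diameter 0, not -oo. *)
Definition diam (X : metricType R) (A : set X) : \bar R :=
  ereal_sup ([set 0%E] `|` [set (mdist x y)%:E | x in A & y in A]).

Definition metric_bounded (X : metricType R) (A : set X) : Prop :=
  (diam A < +oo)%E.

(* A family of subsets of [X] is a set of subsets, so "distinct members" means
   distinct as sets. *)
Definition uniformly_bounded (X : metricType R) (F : set (set X)) : Prop :=
  exists D : R, forall U, F U -> (diam U <= D%:E)%E.

Definition scale_disjoint (X : metricType R) (r : R) (F : set (set X)) : Prop :=
  forall U V, F U -> F V -> U <> V ->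
    forall x y, U x -> V y -> r < mdist x y.

Definition asdim_le (X : metricType R) (n : nat) : Prop :=
  forall r : R, 0 < r ->
    exists F : 'I_n.+1 -> set (set X),
      [/\ forall i, uniformly_bounded (F i),
          forall i, scale_disjoint r (F i)
        & forall x, exists i, exists2 U, F i U & U x].

(* Equal to +oo when no n satisfies [asdim_le X n]. *)
Definition asdim (X : metricType R) : \bar R :=
  ereal_inf [set (n%:R : R)%:E | n in [set n | asdim_le X n]].

End MetricSpace.

Section Maps.
Context {R : realType}.
Variables X Y : metricType R.

Definition large_scale_lipschitz (f : X -> Y) : Prop :=
  exists lambda mu : R, [/\ 0 < lambda, 0 < mu &
    forall x y, mdist (f x) (f y) <= lambda * mdist x y + mu].

(* A finite geodesic [0, M] -> X, given by a function on R of which only the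
   restriction to [0, M] matters. *)
Definition geodesic (M : R) (gamma : R -> X) : Prop :=
  0 <= M /\ {in `[0, M] &, forall s t, mdist (gamma s) (gamma t) = `|s - t|}.

Definition radial_at (x0 : X) (f : X -> Y) : Prop :=
  large_scale_lipschitz f /\
  exists lambda mu : R, [/\ 0 < lambda, 0 < mu &
    forall (M : R) (gamma : R -> X), geodesic M gamma -> gamma 0 = x0 ->
      forall x y, (gamma @` `[0, M]) x -> (gamma @` `[0, M]) y ->
        lambda * mdist x y - mu <= mdist (f x) (f y)].

Definition radial (f : X -> Y) : Prop := exists x0 : X, radial_at x0 f.

Definition coarse (f : X -> Y) : Prop :=
  (forall r : R, exists s : R,
     forall x y, mdist x y < r -> mdist (f x) (f y) < s) /\
  (forall A : set Y, metric_bounded A -> metric_bounded (f @^-1` A)).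

Definition coarsely_to1 (n : nat) (f : X -> Y) : Prop :=
  coarse f /\
  forall r : R, exists s : R, forall A : set Y, (diam A < r%:E)%E ->
    exists B : 'I_n -> set X,
      f @^-1` A = \bigcup_i B i /\ forall i, (diam (B i) < s%:E)%E.

End Maps.

(* Main.v *)
(* Both spaces live on the vertices of the binary tree, seen as the dyadic
   subintervals of [0, 1].  X carries the tree metric; Y carries the metric
   2 log (|x - y| + max(h, h')) - log h - log h' of the hyperbolic cone of
   Bonk and Schramm, where x is the left end and h the length of an interval,
   so that Y is a copy of a piece of the hyperbolic plane; f is the identity.
   On the boundaries f induces the 2-to-1 map from the Cantor set to [0, 1].

   A subset of Y of bounded diameter meets at most two adjacent intervals of a
   suitable coarser level, and points below a common interval are close in the
   tree: this is why f is coarsely 2-to-1.  Since X has integral distances, its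
   geodesics are constant and radial only means large scale Lipschitz here.

   asdim Y > 1: in a long strip of consecutive levels of Y opposite sides are
   far apart, so a cover by two disjoint families of bounded sets would give a
   drawn game of Hex. *)
From HB Require Import structures.
Require Import Defs.
From mathcomp Require Import all_boot all_order all_algebra.
From mathcomp Require Import all_classical all_reals all_analysis.
From mathcomp Require Import zify lra.

Set Implicit Arguments.
Unset Strict Implicit.
Unset Printing Implicit Defensive.

Import Order.TTheory GRing.Theory Num.Theory.
Import numFieldNormedType.Exports.

Local Open Scope classical_set_scope.
Local Open Scope ring_scope.

(** * Hex on a grid *)

(** If all corners are marked, both sides are the sum of the four colours; otherwise the marked
    corners share one colour and all terms vanish. *)
Lemma square_parity (c1 c2 c3 c4 s1 s2 s3 s4 : bool) :
  (c1 == c2) ==> (s1 == s2) -> (c1 == c3) ==> (s1 == s3) ->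
  (c1 == c4) ==> (s1 == s4) -> (c2 == c3) ==> (s2 == s3) ->
  (c2 == c4) ==> (s2 == s4) -> (c3 == c4) ==> (s3 == s4) ->
  [&& c1 (+) c2, s1 & s2] (+) [&& c3 (+) c4, s3 & s4]
    = [&& c1 (+) c3, s1 & s3] (+) [&& c2 (+) c4, s2 & s4].
Proof.
by case: c1 c2 c3 c4 => [] [] [] []; case: s1 s2 s3 s4 => [] [] [] [].
Qed.

(* Hex is never drawn: [c] colours a grid, the players are [c = true], joining
   the left column to the right one, and [c = false], joining the row [b] to the
   row [0]; [s] marks the vertices joined to the starting side of their colour.
   Among the four combinations of [c] and [s], those with the same [c] are never
   adjacent, so around a unit square the number of edges between marked vertices
   of different colours is even; along the left column followed by the row [b],
   it is odd, along the other two sides it is 0. *)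
Lemma no_hex_draw (a b : nat) (c s : nat -> nat -> bool) :
  (forall k j k' j', (k <= a)%N -> (k' <= a)%N -> (j <= b)%N -> (j' <= b)%N ->
     (k <= k'.+1)%N -> (k' <= k.+1)%N -> (j <= j'.+1)%N -> (j' <= j.+1)%N ->
     c k j = c k' j' -> s k j = s k' j') ->
  (forall j, (j <= b)%N -> c 0%N j -> s 0%N j) ->
  (forall j, (j <= b)%N -> c a j -> ~~ s a j) ->
  (forall k, (k <= a)%N -> ~~ c k b -> s k b) ->
  (forall k, (k <= a)%N -> ~~ c k 0%N -> ~~ s k 0%N) ->
  False.
Proof.
move=> adj hl hr ht hb.
pose w k j k' j' := [&& c k j (+) c k' j', s k j & s k' j'].
pose W n j := \big[addb/false]_(k < n) w k j k.+1 j.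
pose same k j k' j' := (c k j == c k' j') ==> (s k j == s k' j').
have sameP k j k' j' : (k <= a)%N -> (k' <= a)%N -> (j <= b)%N -> (j' <= b)%N ->
    (k <= k'.+1)%N -> (k' <= k.+1)%N -> (j <= j'.+1)%N -> (j' <= j.+1)%N ->
    same k j k' j'.
  by move=> *; apply/implyP => /eqP cc; apply/eqP/adj.
(* Summing over the unit squares between the rows [j] and [j.+1] cancels the inner edges. *)
have square n j : (n <= a)%N -> (j < b)%N ->
    W n j.+1 = W n j (+) w 0%N j 0%N j.+1 (+) w n j n j.+1.
  move=> + jb; elim: n => [_|n IH na]; first by rewrite /W !big_ord0 /= addbb.
  rewrite /W !big_ord_recr /= -!/(W _ _) (IH (ltnW na)).
  have : w n j n.+1 j (+) w n j.+1 n.+1 j.+1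
      = w n j n j.+1 (+) w n.+1 j n.+1 j.+1.
    by apply: square_parity; apply: sameP; lia.
  move: (W n j) (w 0%N j 0%N j.+1) (w n j n.+1 j) (w n j.+1 n.+1 j.+1)
    (w n j n j.+1) (w n.+1 j n.+1 j.+1); clear.
  by do 6 case.
(* On the row 0 and on the right column all marked vertices have one colour, so these sides
   contribute nothing. *)
have left j : (j <= b)%N -> W a j = ~~ c 0%N j && s 0%N j.
  elim: j => [_|j IH jb].
    rewrite /W big1 => [|k _].
      by move/implyP: (hb 0%N isT); case: (c 0%N 0%N) (s 0%N 0%N) => [] [].
    move/implyP: (hb k (ltnW (ltn_ord k))); move/implyP: (hb k.+1 (ltn_ord k)).
    rewrite /w; move: (c k _) (c k.+1 _) (s k _) (s k.+1 _); clear.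
    by do 4 case.
  rewrite (square _ _ (leqnn a) jb) (IH (ltnW jb)) /w.
  have : same 0%N j 0%N j.+1 by apply: sameP; lia.
  move/implyP: (hr j (ltnW jb)); move/implyP: (hr j.+1 jb).
  move/implyP: (hl j (ltnW jb)); move/implyP: (hl j.+1 jb).
  rewrite /same; move: (c a j) (c a j.+1) (s a j) (s a j.+1) (c 0%N j)
    (c 0%N j.+1) (s 0%N j) (s 0%N j.+1); clear.
  by do 8 case.
have top n : (n <= a)%N ->
    W n b = (c 0%N b && s 0%N b) (+) (c n b && s n b).
  elim: n => [_|n IH na]; first by rewrite /W big_ord0 addbb.
  rewrite /W big_ord_recr /= -/(W _ _) (IH (ltnW na)) /w.
  have : same n b n.+1 b by apply: sameP; lia.
  move/implyP: (ht n (ltnW na)); move/implyP: (ht n.+1 na).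
  move: (c 0%N b && s 0%N b) => x.
  rewrite /same; move: (c n b) (c n.+1 b) (s n b) (s n.+1 b) x; clear.
  by do 5 case.
(* The corner [(0, b)] is marked whatever its colour, so [left] and [top] give opposite values of
   [W a b]. *)
move: (top a (leqnn _)); rewrite left //.
move/implyP: (hr b (leqnn _)); move/implyP: (hl b (leqnn _)).
move/implyP: (ht 0%N isT).
by move: (c a b) (s a b) (c 0%N b) (s 0%N b); clear; do 4 case.
Qed.

(** * Diameters and bounds on asymptotic dimension *)

Section AsymptoticDimension.
Context {R : realType}.
Implicit Type X : metricType R.

Lemma diam_leP X (A : set X) (D : R) :
  (diam A <= D%:E)%E <->
  0 <= D /\ forall x y, A x -> A y -> mdist x y <= D.
Proof.
split=> [AD | [D0 AD]].
  split=> [|x y Ax Ay]; rewrite -lee_fin; apply: le_trans AD;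
    apply: ereal_sup_ubound; first by left.
  by right; exists x => //; exists y.
apply: ge_ereal_sup => _ [-> | [x Ax [y Ay <-]]]; rewrite lee_fin //.
exact: AD.
Qed.

Lemma diam_ge X (A : set X) (D : \bar R) x y :
  (diam A <= D)%E -> A x -> A y -> ((mdist x y)%:E <= D)%E.
Proof.
move=> AD Ax Ay; apply: le_trans AD; apply: ereal_sup_ubound.
by right; exists x => //; exists y.
Qed.

Lemma asdim_leW X n m : (n <= m)%N -> asdim_le X n -> asdim_le X m.
Proof.
move=> nm Xn r /Xn [F [Fb Fd Fc]].
pose G (i : 'I_m.+1) := if (i < n.+1)%N then F (inord i) else set0.
exists G; split=> [i|i|x].
- by rewrite /G; case: ifP => _ //; exists 0.
- by rewrite /G; case: ifP => _ // U V.
- have [i [U FU Ux]] := Fc x; exists (inord i), U => //.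
  have im : (i < m.+1)%N by rewrite (leq_trans (ltn_ord i)).
  by rewrite /G inordK // ltn_ord inord_val.
Qed.

Lemma asdim_eq X n :
  asdim_le X n.+1 -> ~ asdim_le X n -> asdim X = (n.+1%:R)%:E.
Proof.
move=> le nle; apply/eqP; rewrite eq_le; apply/andP; split.
  by apply: ereal_inf_lbound; exists n.+1.
apply: le_ereal_inf_tmp => _ [m /= Xm <-].
rewrite lee_fin ler_nat ltnNge; apply/negP => mn.
exact/nle/(asdim_leW mn).
Qed.

(** If one [r]-disjoint family covers, a chain of steps at most [r] never leaves the member in which
    it starts. *)
Lemma asdim_gt0 X (r : R) : 0 < r ->
  (forall D, exists2 g : nat -> X, forall k, mdist (g k) (g k.+1) <= r &
     exists n, D < mdist (g 0%N) (g n)) ->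
  ~ asdim_le X 0.
Proof.
move=> r0 chain /(_ r r0) [F [/(_ ord0) [D FD] /(_ ord0) Fd Fc]].
have [g g1 [n]] := chain D; apply/negP; rewrite -leNgt.
have {}Fc x : exists2 U, F ord0 U & U x by have [i] := Fc x; rewrite (ord1 i).
have [U FU U0] := Fc (g 0%N).
have Ug k : U (g k).
  elim: k => // k IH; have [V FV Vk] := Fc (g k.+1).
  have [<- // | UV] := pselect (V = U).
  have := Fd U V FU FV (nesym UV) _ _ IH Vk.
  by rewrite ltNge g1.
by rewrite -lee_fin; apply: diam_ge (FD _ FU) _ _.
Qed.

(** Given two families, colour each grid point by a family covering it. Neighbours of one colour lie
    in the same member, and no member meets opposite sides, which are more than [D] apart: Hex would
    be drawn. *)
Lemma asdim_gt1 X (r : R) : 0 < r ->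
  (forall D, exists a b (g : nat -> nat -> X),
    [/\ forall k j k' j', (k <= a)%N -> (k' <= a)%N -> (j <= b)%N ->
          (j' <= b)%N -> (k <= k'.+1)%N -> (k' <= k.+1)%N ->
          (j <= j'.+1)%N -> (j' <= j.+1)%N -> mdist (g k j) (g k' j') <= r,
        forall j j', (j <= b)%N -> (j' <= b)%N ->
          D < mdist (g 0%N j) (g a j')
      & forall k k', (k <= a)%N -> (k' <= a)%N ->
          D < mdist (g k b) (g k' 0%N)]) ->
  ~ asdim_le X 1.
Proof.
move=> r0 grid /(_ r r0) [F [Fb Fd Fc]].
have [D FD] : exists D : R, forall i U, F i U -> (diam U <= D%:E)%E.
  have [D0 F0] := Fb ord0; have [D1 F1] := Fb ord_max.
  exists (Num.max D0 D1) => i U; have [->|->] : i = ord0 \/ i = ord_max.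
  - by case: i => [[|[|//]] ?]; [left|right]; apply/val_inj.
  - by move=> /F0 /le_trans; apply; rewrite lee_fin le_max lexx.
  - by move=> /F1 /le_trans; apply; rewrite lee_fin le_max lexx orbT.
have {Fb}[a [b [g [g1 glr gtb]]]] := grid D.
have [col colP] := choice Fc.
have /choice[U UP] x : exists V, F (col x) V /\ V x.
  by have [V] := colP x; exists V.
have adj x y : mdist x y <= r -> col x = col y -> U x = U y.
  move=> xy cxy; apply: contrapT => Uxy.
  have [[Fx Ux] [Fy Uy]] := (UP x, UP y).
  rewrite -cxy in Fy.
  by have := Fd _ _ _ Fx Fy Uxy _ _ Ux Uy; rewrite ltNge xy.
have far x y : D < mdist x y -> col x = col y -> U x <> U y.
  move=> Dxy cxy Uxy; have [[Fx Ux] [_ Uy]] := (UP x, UP y).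
  move: Dxy; rewrite ltNge -lee_fin (diam_ge (FD _ _ Fx)) //.
  by rewrite Uxy.
pose c k j := col (g k j) == ord0.
have cP k j k' j' : c k j = c k' j' -> col (g k j) = col (g k' j').
  rewrite /c => cc; apply/val_inj; move: cc.
  case: (col (g k j)) (col (g k' j')) => [[|[|//]] ?] [[|[|//]] ?] //.
(* Marked: the chosen member is also that of a vertex of the same colour on the starting side. *)
pose s k j := `[< if c k j
  then exists j', [/\ (j' <= b)%N, c 0%N j' & U (g 0%N j') = U (g k j)]
  else exists k', [/\ (k' <= a)%N, ~~ c k' b & U (g k' b) = U (g k j)] >].
apply: (@no_hex_draw a b c s).
- move=> k j k' j' ka ka' jb jb' h1 h2 h3 h4 cc.
  rewrite /s -cc; suff -> : U (g k j) = U (g k' j') by [].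
  by apply: adj; [exact: g1 | exact: cP].
- by move=> j jb cj; apply/asboolP; rewrite cj; exists j.
- move=> j jb cj; apply/asboolP; rewrite cj => -[j' [jb' cj' UU]].
  by apply: far UU; [exact: glr | apply: cP; rewrite cj].
- by move=> k ka ck; apply/asboolP; rewrite (negbTE ck); exists k.
- move=> k ka ck; apply/asboolP; rewrite (negbTE ck) => -[k' [ka' ck' UU]].
  apply: far UU; [exact: gtb | apply: cP].
  by rewrite (negbTE ck) (negbTE ck').
Qed.

End AsymptoticDimension.

(** * Binary logarithm *)

Section BinaryLogarithm.
Context {R : realType}.
Implicit Types x y : R.

Definition log2 x : R := ln x / ln 2.

Let ln2_gt0 : 0 < ln 2 :> R.
Proof. by rewrite ln_gt0 ?ltr1n. Qed.

Lemma log2_le x y : 0 < x -> x <= y -> log2 x <= log2 y.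
Proof.
move=> x0 xy; rewrite ler_pM2r ?invr_gt0 // ler_ln // posrE //.
exact: lt_le_trans xy.
Qed.

Lemma log2_inj x y : 0 < x -> 0 < y -> log2 x = log2 y -> x = y.
Proof.
move=> x0 y0 /(divIf (lt0r_neq0 ln2_gt0)); exact: (@ln_inj R).
Qed.

Lemma log2M x y : 0 < x -> 0 < y -> log2 (x * y) = log2 x + log2 y.
Proof. by move=> x0 y0; rewrite /log2 lnM // mulrDl. Qed.

Lemma log2_exp n : log2 (2 ^+ n) = n%:R.
Proof.
by rewrite /log2 lnXn ?ltr0n // -[ln 2 *+ n]mulr_natr mulrAC divff ?mul1r //
  gt_eqF.
Qed.

Lemma log2_expV n : log2 (2 ^- n) = - n%:R.
Proof. by rewrite /log2 lnV ?posrE ?exprn_gt0 // mulNr -/(log2 _) log2_exp. Qed.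

(** Turns the triangle inequality of a radius into an ultrametric inequality for its logarithm, up
    to an error 1. *)
Lemma log2_double x y z : 0 < x -> x <= y + z -> z <= y ->
  log2 x <= 1 + log2 y.
Proof.
move=> x0 xyz zy; have y0 : 0 < y by lra.
by rewrite -[1]/(1%:R) -(log2_exp 1) -log2M // log2_le //; lra.
Qed.

End BinaryLogarithm.

(** * Vertices of the binary tree *)

Definition vertex := {n : nat & 'I_(2 ^ n)}.

Definition lev (p : vertex) : nat := tag p.

Definition idx (p : vertex) : nat := tagged p.

Lemma vertex_inj p q : lev p = lev q -> idx p = idx q -> p = q.
Proof.
case: p q => [n k] [m l] /= nm; rewrite /lev /= in nm; case: _ / nm l => l.
by rewrite /idx /= => /val_inj ->.
Qed.

Lemma finite_lev N : finite_set [set p | (lev p <= N)%N].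
Proof.
apply: (@sub_finite_set _ _
  (\bigcup_(n in `I_N.+1) range (@Tagged _ n (fun n => 'I_(2 ^ n))))).
  by case=> n k /= nN; exists n => //; exists k.
apply: bigcup_finite => [|n _]; first exact: finite_II.
by apply: finite_image; exact: finite_finset.
Qed.

(** * Cones: metric, properness, hyperbolicity *)

(* [rad p q] plays the role of the height of the lowest point of a path from
   [p] to [q]; the heights themselves are [2 ^- lev p]. *)
Record radius (R : realType) := Radius {
  rad :> vertex -> vertex -> R;
  rad_sym : forall p q, rad p q = rad q p;
  rad_diag : forall p, rad p p = 2 ^- lev p;
  rad_ge : forall p q, 2 ^- lev p <= rad p q;
  rad_triangle : forall z p q, rad p q <= rad p z + rad z q;
  rad_mul : forall z p q, rad p q * 2 ^- lev z <= rad p z * rad z q;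
  rad_inj : forall p q, rad p q = 2 ^- lev p -> rad p q = 2 ^- lev q -> p = q
}.

(** The parameter [rho], absent from the body, lets the same set of vertices carry one metric for
    each radius. *)
Definition cone (R : realType) (rho : radius R) : Type := vertex.

HB.instance Definition _ (R : realType) (rho : radius R) :=
  Choice.on (cone rho).

Section Cone.
Context {R : realType}.
Variable rho : radius R.
Implicit Types p q z : cone rho.

Definition cone_dist p q : R :=
  2 * log2 (rho p q) + (lev p)%:R + (lev q)%:R.

Let exp_gt0 n : 0 < 2 ^- n :> R.
Proof. by rewrite invr_gt0 exprn_gt0. Qed.

Lemma rad_gt0 p q : 0 < rho p q.
Proof. exact: lt_le_trans (rad_ge rho p q). Qed.

Let cone_dist_refl p : cone_dist p p = 0.
Proof. by rewrite /cone_dist rad_diag log2_expV; lra. Qed.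

Let cone_dist_sym p q : cone_dist p q = cone_dist q p.
Proof. by rewrite /cone_dist rad_sym; lra. Qed.

Let cone_dist_ge p q n : 2 ^- n <= rho p q ->
  (lev p)%:R + (lev q)%:R - 2 * n%:R <= cone_dist p q.
Proof.
by move=> /(log2_le (exp_gt0 n)); rewrite log2_expV /cone_dist; lra.
Qed.

Let cone_dist_inj p q : cone_dist p q = 0 -> p = q.
Proof.
move=> d0; have := cone_dist_ge (rad_ge rho p q).
have := rad_ge rho q p; rewrite rad_sym => /cone_dist_ge.
move: (d0); rewrite {1}/cone_dist d0 => l0 h1 h2.
have nm : (lev p)%:R = (lev q)%:R :> R by lra.
by apply: (@rad_inj _ rho); apply: log2_inj; rewrite ?rad_gt0 // log2_expV; lra.
Qed.

Let cone_dist_triangle z p q : cone_dist p q <= cone_dist p z + cone_dist z q.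
Proof.
have := log2_le (mulr_gt0 (rad_gt0 p q) (exp_gt0 _)) (rad_mul rho z p q).
by rewrite !log2M ?rad_gt0 // log2_expV /cone_dist; lra.
Qed.

HB.instance Definition _ := isMetric.Build R (cone rho)
  cone_dist_refl cone_dist_inj cone_dist_sym cone_dist_triangle.

Lemma mdist_coneE p q :
  mdist p q = 2 * log2 (rho p q) + (lev p)%:R + (lev q)%:R.
Proof. by []. Qed.

Lemma cone_ge p q n : 2 ^- n <= rho p q ->
  (lev p)%:R + (lev q)%:R - 2 * n%:R <= mdist p q.
Proof. exact: cone_dist_ge. Qed.

Lemma cone_le p q c n : rho p q <= 2 ^+ c * 2 ^- n ->
  mdist p q <= (lev p)%:R + (lev q)%:R + 2 * c%:R - 2 * n%:R.
Proof.
move=> /(log2_le (rad_gt0 _ _)); rewrite log2M ?exprn_gt0 // log2_expV log2_exp.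
by rewrite mdist_coneE; lra.
Qed.

Lemma cone_lev p q : (lev q)%:R - (lev p)%:R <= mdist p q.
Proof. by have := cone_ge (rad_ge rho p q); lra. Qed.

(** Balls are finite, since the distance bounds the difference of levels and each level is
    finite. *)
Lemma proper_cone : proper_space (cone rho).
Proof.
move=> p r; apply: finite_compact.
pose N := (lev p + (Num.truncn `|r|%R).+1)%N.
apply: sub_finite_set (finite_lev N) => q /= pq.
rewrite -(ler_nat R) natrD; have := cone_lev p q.
have := ler_norm r; have := truncnS_gt `|r|; lra.
Qed.

(** In the four-point form of the inequality the levels cancel. What remains concerns [L] with an
    error [8 / 4 = 2], one error 1 of [log2_double] for each of [L x y] and [L z o]. *)
Lemma hyperbolic_cone : hyperbolic (cone rho).
Proof.
exists 8 => x y z o.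
pose L (p q : cone rho) := log2 (rho p q).
have Ls p q : L p q = L q p by rewrite /L rad_sym.
have dbl w p q : rho w q <= rho p w -> L p q <= 1 + L p w.
  by apply: log2_double; [exact: rad_gt0 | exact: rad_triangle].
have [h|h] : L x y + L z o <= 2 + (L x z + L y o) \/
             L x y + L z o <= 2 + (L z y + L x o).
(* [L x y] can be bounded through [z] or [o], and [L z o] through [x] or [y]; the order of the four
   other radii selects the bounds to add. *)
- have := dbl z x y; have := dbl o x y; have := dbl x z o; have := dbl y z o.
  have := dbl z y x; have := dbl o y x; have := dbl x o z; have := dbl y o z.
  rewrite !(Ls y x, Ls o z, Ls z x, Ls o y, Ls y z, Ls o x).
  rewrite !(rad_sym rho o y, rad_sym rho z x, rad_sym rho y z, rad_sym rho o x).
  move=> hCB hAD hDB hAC hBC hDA hBD hCA.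
  have [iAC|/ltW iAC] := leP (rho x z) (rho z y);
  have [iBD|/ltW iBD] := leP (rho y o) (rho x o);
  have [iAD|/ltW iAD] := leP (rho x z) (rho x o);
  have [iBC|/ltW iBC] := leP (rho y o) (rho z y);
  try (move: (hAC iAC) => {}hAC); try (move: (hCA iAC) => {}hCA);
  try (move: (hBD iBD) => {}hBD); try (move: (hDB iBD) => {}hDB);
  try (move: (hAD iAD) => {}hAD); try (move: (hDA iAD) => {}hDA);
  try (move: (hBC iBC) => {}hBC); try (move: (hCB iBC) => {}hCB);
  solve [left; lra | right; lra].
- rewrite /gromov_product !mdist_coneE -!/(L _ _) lerBlDr ge_min.
  by apply/orP; left; lra.
- rewrite /gromov_product !mdist_coneE -!/(L _ _) lerBlDr ge_min.
  by apply/orP; right; lra.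
Qed.

End Cone.

(** * Ancestors and their indices *)

(** For [n > lev p] this is the index of the leftmost descendant of [p] at level [n]. *)
Definition anc (p : vertex) (n : nat) : nat := (idx p * 2 ^ n) %/ 2 ^ lev p.

Definition vtx (n k : nat) : vertex :=
  Tagged (fun n => 'I_(2 ^ n)) (Ordinal (ltn_pmod k (expn_gt0 2 n))).

Lemma lev_vtx n k : lev (vtx n k) = n. Proof. by []. Qed.

Lemma idx_vtx n k : (k < 2 ^ n)%N -> idx (vtx n k) = k.
Proof. exact: modn_small. Qed.

Lemma idx_lt p : (idx p < 2 ^ lev p)%N.
Proof. exact: ltn_ord. Qed.

Lemma anc0 p : anc p 0 = 0%N.
Proof. by rewrite /anc muln1 divn_small // idx_lt. Qed.

Lemma anc_lev p : anc p (lev p) = idx p.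
Proof. by rewrite /anc mulnK // expn_gt0. Qed.

Lemma anc_anc p m n : (m <= n)%N -> anc p m = (anc p n %/ 2 ^ (n - m))%N.
Proof.
move=> mn; rewrite /anc -divnMA -{1}(subnKC mn) expnD mulnA.
by rewrite divnMr // expn_gt0.
Qed.

Lemma anc_eqW p q m n : (m <= n)%N -> anc p n = anc q n -> anc p m = anc q m.
Proof. by move=> mn pq; rewrite !(anc_anc _ mn) pq. Qed.

Lemma anc_vtx N k n m : (k < 2 ^ N)%N -> (m <= n)%N -> (n <= N)%N ->
  anc (vtx n (k %/ 2 ^ (N - n))) m = (k %/ 2 ^ (N - m))%N.
Proof.
move=> kN mn nN; rewrite (anc_anc _ mn) {1}/anc lev_vtx idx_vtx.
  rewrite mulnK ?expn_gt0 // -divnMA -expnD; congr (_ %/ 2 ^ _)%N; lia.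
by rewrite ltn_divLR ?expn_gt0 // -expnD subnKC.
Qed.

(** A level, not a vertex; level 0 always qualifies. *)
Definition lca (p q : vertex) : nat :=
  \max_(n < (minn (lev p) (lev q)).+1 | anc p n == anc q n) n.

Lemma lca_ge p q n : (n <= lev p)%N -> (n <= lev q)%N -> anc p n = anc q n ->
  (n <= lca p q)%N.
Proof.
move=> np nq pq; have nm : (n < (minn (lev p) (lev q)).+1)%N.
  by rewrite ltnS leq_min np.
by apply: (@leq_bigmax_cond _ _ _ (Ordinal nm)); apply/eqP.
Qed.

Lemma lcaP p q :
  [/\ (lca p q <= lev p)%N, (lca p q <= lev q)%N
    & anc p (lca p q) = anc q (lca p q)].
Proof.
have [|n /eqP pq e] := @eq_bigmax_cond _
  [pred n : 'I_(minn (lev p) (lev q)).+1 | anc p n == anc q n] (@nat_of_ord _).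
  by apply/card_gt0P; exists ord0; rewrite inE !anc0.
have {e}-> : lca p q = n by exact: e.
by have := ltn_ord n; rewrite ltnS leq_min => /andP[].
Qed.

Lemma lcaC p q : lca p q = lca q p.
Proof. by rewrite /lca minnC; apply: eq_bigl => n; rewrite eq_sym. Qed.

Lemma lcaxx p : lca p p = lev p.
Proof.
by apply/eqP; rewrite eqn_leq lca_ge // andbT; have [] := lcaP p p.
Qed.

Lemma lca_min z p q : (minn (lca p z) (lca z q) <= lca p q)%N.
Proof.
have [pz_p pz_z pz] := lcaP p z; have [zq_z zq_q zq] := lcaP z q.
apply: lca_ge; first by rewrite geq_min pz_p.
  by rewrite geq_min zq_q orbT.
by rewrite (anc_eqW (geq_minl _ _) pz) (anc_eqW (geq_minr _ _) zq).
Qed.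

(** * The radii of the tree and of the arc *)

Section Radii.
Variable R : realType.

Let exp_le m n : (m <= n)%N -> 2 ^- n <= 2 ^- m :> R.
Proof.
by move=> mn; rewrite lef_pV2 ?posrE ?exprn_gt0 // ler_weXn2l ?ler1n.
Qed.

Let exp_ge0 n : 0 <= 2 ^- n :> R.
Proof. by rewrite invr_ge0 exprn_ge0. Qed.

Let exp_inj m n : 2 ^- m = 2 ^- n :> R -> m = n.
Proof.
by move=> /invr_inj; apply: ieexprIn; rewrite ?ltr0n ?pnatr_eq1.
Qed.

Definition tree_rad p q : R := 2 ^- lca p q.

(** Both [rad_triangle] and [rad_mul] follow from this. *)
Let tree_rad_ultra z p q :
  tree_rad p q <= Num.max (tree_rad p z) (tree_rad z q).
Proof.
have := lca_min z p q; rewrite /tree_rad le_max.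
by case: (leqP (lca p z) (lca z q)) => _ /exp_le ->; rewrite ?orbT.
Qed.

Let tree_rad_sym p q : tree_rad p q = tree_rad q p.
Proof. by rewrite /tree_rad lcaC. Qed.

Let tree_rad_diag p : tree_rad p p = 2 ^- lev p.
Proof. by rewrite /tree_rad lcaxx. Qed.

Let tree_rad_ge p q : 2 ^- lev p <= tree_rad p q.
Proof. by apply: exp_le; have [] := lcaP p q. Qed.

Let tree_rad_triangle z p q : tree_rad p q <= tree_rad p z + tree_rad z q.
Proof.
apply: le_trans (tree_rad_ultra z p q) _.
by rewrite ge_max lerDl lerDr !exp_ge0.
Qed.

Let tree_rad_mul z p q :
  tree_rad p q * 2 ^- lev z <= tree_rad p z * tree_rad z q.
Proof.
have := tree_rad_ultra z p q; rewrite le_max => /orP[] h.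
  by apply: ler_pM => //; apply: exp_ge0.
by rewrite mulrC ler_pM // ?exp_ge0 // tree_rad_sym.
Qed.

Let tree_rad_inj p q :
  tree_rad p q = 2 ^- lev p -> tree_rad p q = 2 ^- lev q -> p = q.
Proof.
move=> /exp_inj lp /exp_inj lq; apply: vertex_inj; first by rewrite -lp.
by have [_ _] := lcaP p q; rewrite {1}lp lq !anc_lev.
Qed.

Definition tree_radius : radius R := Radius tree_rad_sym tree_rad_diag
  tree_rad_ge tree_rad_triangle tree_rad_mul tree_rad_inj.

Definition pos (p : vertex) : R := (idx p)%:R / 2 ^+ lev p.

Lemma pos_anc p n :
  (anc p n)%:R * 2 ^- n <= pos p < ((anc p n)%:R + 1) * 2 ^- n.
Proof.
have := leq_divM (idx p * 2 ^ n) (2 ^ lev p).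
have := ltn_ceil (idx p * 2 ^ n) (expn_gt0 2 (lev p)).
rewrite -(ltr_nat R) -(ler_nat R) -/(anc p n) !natrM !natrX.
rewrite -[(anc p n).+1%:R]natr1.
have u0 : 0 < 2 ^+ lev p :> R by rewrite exprn_gt0.
have v0 : 0 < 2 ^+ n :> R by rewrite exprn_gt0.
move=> h1 h2; rewrite /pos; apply/andP; split.
  by rewrite ler_pdivlMr // mulrAC ler_pdivrMr.
by rewrite ltr_pdivlMr // mulrAC ltr_pdivrMr.
Qed.

Definition arc_rad p q : R := `|pos p - pos q| + 2 ^- minn (lev p) (lev q).

Let expV_minn m n : 2 ^- minn m n = Num.max (2 ^- m) (2 ^- n) :> R.
Proof.
case: (leqP m n) => [/exp_le|/ltnW /exp_le] h; first by rewrite max_l.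
by rewrite max_r.
Qed.

Let arc_rad_sym p q : arc_rad p q = arc_rad q p.
Proof. by rewrite /arc_rad distrC minnC. Qed.

Let arc_rad_diag p : arc_rad p p = 2 ^- lev p.
Proof. by rewrite /arc_rad subrr normr0 add0r minnn. Qed.

Let arc_rad_ge p q : 2 ^- lev p <= arc_rad p q.
Proof.
rewrite /arc_rad expV_minn; have := normr_ge0 (pos p - pos q).
have : 2 ^- lev p <= Num.max (2 ^- lev p) (2 ^- lev q) :> R.
  by rewrite le_max lexx.
lra.
Qed.

Let arc_rad_triangle z p q : arc_rad p q <= arc_rad p z + arc_rad z q.
Proof.
rewrite /arc_rad !expV_minn; have := ler_distD (pos z) (pos p) (pos q).
move: (2 ^- lev p) (2 ^- lev q) (2 ^- lev z) (exp_ge0 (lev z)) => a b c c0.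
set M := Num.max a c; set N := Num.max c b.
have [aM cM] : a <= M /\ c <= M by rewrite !le_max !lexx orbT.
have [cN bN] : c <= N /\ b <= N by rewrite !le_max !lexx orbT.
have : Num.max a b <= M + N by rewrite ge_max; lra.
lra.
Qed.

(* Expand the product on the right and drop the term quadratic in [pos]. *)
Let arc_rad_mul z p q : arc_rad p q * 2 ^- lev z <= arc_rad p z * arc_rad z q.
Proof.
rewrite /arc_rad !expV_minn; have := ler_distD (pos z) (pos p) (pos q).
have := normr_ge0 (pos p - pos z); have := normr_ge0 (pos z - pos q).
move: `|pos p - pos q| `|pos p - pos z| `|pos z - pos q| => x y w w0 y0 xyw.
move: (2 ^- lev p) (2 ^- lev q) (2 ^- lev z) (exp_ge0 (lev p))
  (exp_ge0 (lev q)) (exp_ge0 (lev z)) => a b c a0 b0 c0.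
set M := Num.max a c; set N := Num.max c b.
have [aM cM] : a <= M /\ c <= M by rewrite !le_max !lexx orbT.
have [cN bN] : c <= N /\ b <= N by rewrite !le_max !lexx orbT.
have : Num.max a b * c <= M * N.
  by case: (leP a b) => _; [rewrite mulrC|]; apply: ler_pM.
have := ler_wpM2l y0 cN; have := ler_wpM2l w0 cM; have := mulr_ge0 y0 w0.
have := ler_wpM2r c0 xyw; lra.
Qed.

Let arc_rad_inj p q :
  arc_rad p q = 2 ^- lev p -> arc_rad p q = 2 ^- lev q -> p = q.
Proof.
move=> hp hq; have /exp_inj pq : 2 ^- lev p = 2 ^- lev q :> R by rewrite -hp.
apply: vertex_inj => //; move: hp; rewrite /arc_rad /pos -pq minnn.
move/eqP; rewrite -subr_eq0 addrK -mulrBl normr_eq0 mulf_eq0 invr_eq0.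
by rewrite expf_eq0 pnatr_eq0 andbF orbF subr_eq0 eqr_nat => /eqP.
Qed.

Definition arc_radius : radius R := Radius arc_rad_sym arc_rad_diag
  arc_rad_ge arc_rad_triangle arc_rad_mul arc_rad_inj.

End Radii.

(** * Distance estimates in the two cones *)

Section TreeAndArc.
Variable R : realType.

Notation X := (cone (tree_radius R)).
Notation Y := (cone (arc_radius R)).

Lemma mdist_treeE (p q : X) :
  mdist p q = (lev p)%:R + (lev q)%:R - 2 * (lca p q)%:R.
Proof. by rewrite mdist_coneE [log2 _]log2_expV; lra. Qed.

Lemma tree_le n (p q : X) : (n <= lev p)%N -> (n <= lev q)%N ->
  anc p n = anc q n -> mdist p q <= (lev p)%:R + (lev q)%:R - 2 * n%:R.
Proof.
move=> np nq pq; rewrite mdist_treeE.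
by have := lca_ge np nq pq; rewrite -(ler_nat R); lra.
Qed.

Lemma tree_le_lev (p q : X) : mdist p q <= (lev p)%:R + (lev q)%:R.
Proof. by have := @tree_le 0 p q isT isT; rewrite !anc0 => /(_ erefl); lra. Qed.

(** Left ends differ by at most twice [2 ^- n] and heights are at most [2 ^- n], so the radius is at
    most [2 ^+ 2 * 2 ^- n]; twice the exponent 2 is the 4. *)
Lemma arc_le n (p q : Y) : (n <= lev p)%N -> (n <= lev q)%N ->
  (anc p n <= (anc q n).+1)%N -> (anc q n <= (anc p n).+1)%N ->
  mdist p q <= (lev p)%:R + (lev q)%:R + 4 - 2 * n%:R.
Proof.
move=> np nq; rewrite -!(ler_nat R) -![_.+1%:R]natr1 => pq qp.
have n0 : 0 < 2 ^- n :> R by rewrite invr_gt0 exprn_gt0.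
have /andP[p1 p2] := pos_anc R p n; have /andP[q1 q2] := pos_anc R q n.
suff : arc_radius R p q <= 2 ^+ 2 * 2 ^- n by move=> /cone_le; lra.
rewrite /= /arc_rad (_ : 2 ^+ 2 = 4); last by rewrite -natrX.
have : 2 ^- minn (lev p) (lev q) <= 2 ^- n :> R.
  by rewrite lef_pV2 ?posrE ?exprn_gt0 // ler_weXn2l ?ler1n // leq_min np.
suff : `|pos R p - pos R q| <= 2 * 2 ^- n by lra.
by rewrite ler_norml; apply/andP; split; nra.
Qed.

(** A full cell of level [n] separates the left ends. *)
Lemma arc_ge n (p q : Y) : ((anc p n).+1 < anc q n)%N ->
  (lev p)%:R + (lev q)%:R - 2 * n%:R <= mdist p q.
Proof.
move=> pq; apply: cone_ge; rewrite /= /arc_rad.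
have n0 : 0 < 2 ^- n :> R by rewrite invr_gt0 exprn_gt0.
have /andP[p1 p2] := pos_anc R p n; have /andP[q1 q2] := pos_anc R q n.
have : (anc p n)%:R + 2 <= (anc q n)%:R :> R by rewrite -natrD ler_nat addn2.
have := ler_norm (- (pos R p - pos R q)); rewrite normrN.
have : 0 <= 2 ^- minn (lev p) (lev q) :> R by rewrite invr_ge0 exprn_ge0.
by nra.
Qed.

Lemma natr_gt (r : R) : exists2 K, (0 < K)%N & r < K%:R.
Proof.
exists (Num.truncn `|r|).+1 => //.
exact: le_lt_trans (ler_norm r) (truncnS_gt _).
Qed.

Lemma divn_far K m n : (0 < K)%N -> ((m %/ K).+1 < n %/ K)%N -> (m + K <= n)%N.
Proof.
move=> K0 mn; have := ltn_ceil m K0; have := leq_divM n K.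
by have := leq_mul mn (leqnn K); rewrite !mulSn; lia.
Qed.

(** * Asymptotic dimension of the tree *)

(** Bands of [K > r] levels alternate between the families and are cut according to the ancestor [K]
    levels closer to the root (the root itself for the first band). Bands of one family are a band
    apart; a path between two pieces of a band climbs more than [K] levels. *)
Lemma asdim_tree_le1 : asdim_le X 1.
Proof.
move=> r r0; have [K K0 rK] := natr_gt r.
pose U t a : set X := [set p | (lev p %/ K = t /\ anc p (t * K - K) = a)%N].
exists (fun i => [set V | exists t a, (t %% 2 = i)%N /\ V = U t a]).
split.
- move=> i; exists (4 * K%:R) => _ [t [a [_ ->]]]; apply/diam_leP.
  split=> [|p q [pt pa] [qt qa]]; first by rewrite mulr_ge0.
  have pK : (t * K <= lev p < t * K + K)%N by nia.
  have qK : (t * K <= lev q < t * K + K)%N by nia.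
  have := @tree_le (t * K - K) p q ltac:(lia) ltac:(lia) (etrans pa (esym qa)).
  have : (lev p + lev q <= 2 * (t * K - K) + 4 * K)%N by lia.
  by rewrite -(ler_nat R) !(natrM, natrD); lra.
- move=> i _ _ [t [a [ti ->]]] [t' [a' [ti' ->]]] UU p q [pt pa] [qt qa].
  apply: (lt_le_trans rK).
  have [tt|tt] := eqVneq t t'; last first.
    have [|] : (lev p + K <= lev q \/ lev q + K <= lev p)%N.
    + have : ((lev p %/ K).+2 <= lev q %/ K \/ (lev q %/ K).+2 <= lev p %/ K)%N.
        by rewrite pt qt; lia.
      by case=> h; [left | right]; apply: divn_far.
    + by have := cone_lev p q; rewrite -(ler_nat R) natrD; lra.
    + by have := cone_lev q p; rewrite -(ler_nat R) natrD metric_sym; lra.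
  rewrite -tt in UU qt qa.
  have aa : a <> a' by move=> aa; apply: UU; exact: congr1 aa.
  have lJ : (lca p q < t * K - K)%N.
    rewrite ltnNge; apply/negP => Jl; apply: aa; rewrite -pa -qa.
    by have [_ _] := lcaP p q; apply: anc_eqW.
  have : (K + 2 * lca p q <= lev p + lev q)%N by nia.
  by rewrite mdist_treeE -(ler_nat R) !(natrM, natrD); lra.
- move=> p; pose t := (lev p %/ K)%N.
  exists (inord (t %% 2)%N), (U t (anc p (t * K - K))) => //.
  by exists t, (anc p (t * K - K)); rewrite inordK // ltn_mod.
Qed.

Lemma asdim_tree_gt0 : ~ asdim_le X 0.
Proof.
(* The chain is the leftmost branch. *)
apply: (@asdim_gt0 _ _ 1) => // D; exists (fun n => vtx n 0) => [n|].
  have := @tree_le n (vtx n 0) (vtx n.+1 0).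
  rewrite !lev_vtx /anc /idx /= !mod0n !div0n -natr1 => /(_ _ _ erefl) h.
  by apply: le_trans (h _ _) _ => //; lra.
have [n _ Dn] := natr_gt D; exists n; apply: lt_le_trans Dn _.
by apply: le_trans (cone_lev _ _); rewrite !lev_vtx; lra.
Qed.

(** * Asymptotic dimension of the arc cone *)

(** [B = A.+1] would be a multiple of [M]. This keeps a full cell between different pieces of a
    block. *)
Lemma divn_gap M A B : (0 < M)%N -> ~~ (M %| A.+1)%N -> (A %/ M < B %/ M)%N ->
  (A.+1 < B)%N.
Proof.
move=> M0 MA; rewrite !ltnNge; apply: contra => /(leq_div2r M).
by rewrite divnS // (negbTE MA).
Qed.

Lemma asdim_arc_le2 : asdim_le Y 2.
Proof.
move=> r r0; have [K K0 rK] := natr_gt r.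
(* A point of band t is a candidate for the two colours i <> t mod 3; the colour
   i joins two consecutive bands into a block, cut into pieces at the cells of
   level [J i b] that are congruent to 1 modulo [M]. A cell below such a cell,
   [K] levels further down, is never of this kind ([holeS]), so that a point
   excluded from one of its two colours is covered by the other. *)
pose M := (2 ^ K.+1)%N.
have M1 : (1 < M)%N by rewrite -(expn0 2) ltn_exp2l.
have shift A B : ((A + M - 2).+1 < B + M - 2 -> A.+1 < B)%N by lia.
(* The block [b] of colour [i] consists of the bands [3b + i - 2] and [3b + i - 1]; [J i b] lies [K]
   levels closer to the root, truncated at 0. *)
pose J (i b : nat) := (K * (3 * b + i) - 3 * K)%N.
pose band (p : Y) := (lev p %/ K)%N.
pose block (i : nat) (p : Y) := ((band p + 2 - i) %/ 3)%N.
(* The shift puts each hole at the end of a run of [M] cells, so that [%/ M] numbers the pieces. The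
   residue 1, unlike 0, never occurs at the root. *)
pose sh p n := (anc p n + M - 2)%N.
pose hole p n := (M %| (sh p n).+1)%N.
have holeE p n : hole p n = (anc p n %% M == 1)%N.
  rewrite /hole /sh -(modnDr _ M) -[X in _ = (_ == X)%N](modn_small M1).
  by rewrite eqn_mod_dvd; [congr (_ %| _)%N; lia | lia].
have hole0 p : ~~ hole p 0%N by rewrite holeE anc0 mod0n.
(* A hole [q * M + 1 = 2 * q * 2 ^ K + 1] has the ancestor [2 * q], even like [M], hence not
   congruent to 1. *)
have holeS p n : hole p n -> ~~ hole p (n + K)%N.
  rewrite !holeE (anc_anc p (leq_addr K n)) addKn => /eqP h; apply/eqP => h'.
  have K1 : (1 < 2 ^ K)%N by rewrite -(expn0 2) ltn_exp2l.
  have e : (anc p (n + K) = anc p (n + K) %/ M * 2 * 2 ^ K + 1)%N.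
    by have := divn_eq (anc p (n + K)) M; rewrite h' -mulnA -expnS.
  rewrite e divnMDl ?expn_gt0 // (divn_small K1) addn0 in h.
  have := divn_eq (anc p (n + K) %/ M * 2) M; rewrite h /M expnS; lia.
pose U (i b a : nat) : set Y := [set p |
  [/\ band p %% 3 != i, block i p = b, ~~ hole p (J i b)
    & sh p (J i b) %/ M = a]%N].
have lev_in (i : 'I_3) b a p : U i b a p ->
    (K * (3 * b + i) <= lev p + 2 * K /\ lev p < K * (3 * b + i))%N.
  move=> [+ + _ _]; rewrite /block /band => h1 h2.
  have : (3 * b + i <= lev p %/ K + 2 /\ lev p %/ K < 3 * b + i)%N.
    by move: (lev p %/ K)%N h1 h2 (ltn_ord i) => t; lia.
  by move=> [h3 h4]; split; nia.
(* A piece lies in a run of [M] cells, which meets at most two adjacent cells [K.+1] levels closer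
   to the root. *)
have anc_in i b a p q : U i b a p -> U i b a q ->
    (anc p (J i b - K.+1) <= (anc q (J i b - K.+1)).+1)%N.
  move=> [_ _ _ pa] [_ _ _ qa].
  have [JK|KJ] := leqP (J i b) K.+1; first by rewrite (eqP JK) !anc0.
  rewrite !(anc_anc _ (leq_subr K.+1 (J i b))) subKn ?(ltnW KJ) // -/M.
  have <- : ((anc q (J i b) + M) %/ M = (anc q (J i b) %/ M).+1)%N.
    by rewrite divnDr // divnn (ltnW M1) addn1.
  apply: (@leq_trans (sh q (J i b) %/ M)).
    by rewrite qa -pa; apply: leq_div2r; rewrite /sh; lia.
  by apply: leq_div2r; rewrite /sh; lia.
exists (fun i => [set V | exists b a, V = U i b a]); split.
- move=> i; exists (8 * K%:R + 6) => _ [b [a ->]]; apply/diam_leP.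
  split=> [|p q Up Uq]; first by rewrite addr_ge0 // mulr_ge0.
  have [lp1 lp2] := lev_in i b a p Up; have [lq1 lq2] := lev_in i b a q Uq.
  have := @arc_le (J i b - K.+1) p q ltac:(rewrite /J; lia)
    ltac:(rewrite /J; lia) (anc_in _ _ _ _ _ Up Uq) (anc_in _ _ _ _ _ Uq Up).
  have : (lev p + lev q <= 2 * (J i b - K.+1) + 8 * K + 2)%N by rewrite /J; lia.
  by rewrite -(ler_nat R) !(natrM, natrD); lra.
- move=> i _ _ [b [a ->]] [b' [a' ->]] UU p q Up Uq; apply: (lt_le_trans rK).
  have [lp1 lp2] := lev_in i b a p Up; have [lq1 lq2] := lev_in i b' a' q Uq.
  move: Up Uq => [pi pb pJ pa] [qi qb qJ qa]; have i3 := ltn_ord i.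
  rewrite /block /band in pb qb pi qi.
  have [bb|bb] := eqVneq b b'; last first.
    have [|] : (lev p + K <= lev q \/ lev q + K <= lev p)%N.
    + have : ((lev p %/ K).+2 <= lev q %/ K \/ (lev q %/ K).+2 <= lev p %/ K)%N.
        by move: (lev p %/ K)%N (lev q %/ K)%N pi pb qi qb => t t'; lia.
      by case=> h; [left | right]; apply: divn_far.
    + by have := cone_lev p q; rewrite -(ler_nat R) natrD; lra.
    + by have := cone_lev q p; rewrite -(ler_nat R) natrD metric_sym; lra.
  rewrite -bb in UU qb qJ qa lq1 lq2.
  have aa : a <> a' by move=> aa; apply: UU; exact: congr1 aa.
  have J0 : (0 < J i b)%N.
    rewrite lt0n; apply/eqP => J0; apply: aa; rewrite -pa -qa.
    by rewrite /sh J0 !anc0.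
  have : (K + 2 * J i b <= lev p + lev q)%N by rewrite /J in J0 *; lia.
  rewrite -(ler_nat R) !(natrM, natrD).
  have [h|h] : (sh p (J i b) %/ M < sh q (J i b) %/ M \/
                sh q (J i b) %/ M < sh p (J i b) %/ M)%N.
    by apply/orP; rewrite -neq_ltn pa qa; apply/eqP.
    have {}h := divn_gap (ltnW M1) pJ h.
    by have := @arc_ge (J i b) p q (shift _ _ h); lra.
  have {}h := divn_gap (ltnW M1) qJ h.
  have := @arc_ge (J i b) q p (shift _ _ h).
  by rewrite metric_sym; lra.
- move=> p.
  have [i i1 i2] : exists2 i : 'I_3, (band p %% 3 != i)%N &
      ~~ hole p (J i (block i p)).
    pose i1 : 'I_3 := inord ((band p + 1) %% 3).
    pose i2 : 'I_3 := inord ((band p + 2) %% 3).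
    have e1 : i1 = ((band p + 1) %% 3)%N :> nat by rewrite inordK // ltn_mod.
    have e2 : i2 = ((band p + 2) %% 3)%N :> nat by rewrite inordK // ltn_mod.
    have J1 : J i1 (block i1 p) = (band p * K - 2 * K)%N.
      rewrite /J (_ : 3 * block i1 p + i1 = band p + 1)%N; first by nia.
      by rewrite /block e1; lia.
    have J2 : J i2 (block i2 p) = (band p * K - K)%N.
      rewrite /J (_ : 3 * block i2 p + i2 = band p + 2)%N; first by nia.
      by rewrite /block e2; lia.
    have [h|h] := boolP (hole p (J i1 (block i1 p))).
      exists i2; first by rewrite e2; lia.
      move: (h); rewrite J1 J2 => /holeS.
      (* The root is no hole, so the subtraction is not truncated and the two levels differ by
         exactly [K]. *)
      have : (0 < band p * K - 2 * K)%N.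
        rewrite lt0n; apply: contraTneq h; rewrite J1 => ->; exact: hole0.
      by move=> h0; rewrite (_ : _ + K = band p * K - K)%N //; lia.
    by exists i1 => //; rewrite e1; lia.
  exists i, (U i (block i p) (sh p (J i (block i p)) %/ M)%N) => //.
  by eexists; eexists.
Qed.

(** Column [k] of the grid consists of the ancestors, at levels [T] to [2 * T], of the cell [k] of
    level [2 * T]. Neighbours differ by at most one level, whence [5 = 1 + 4] by [arc_le]. *)
Lemma asdim_arc_gt1 : ~ asdim_le Y 1.
Proof.
apply: (@asdim_gt1 _ _ 5) => // D; have [T T0 DT] := natr_gt D.
have [N NT] : exists N, N = (2 * T)%N by exists (2 * T)%N.
pose g k j : Y := vtx (T + j) (k %/ 2 ^ (N - (T + j))).
have N0 : (0 < 2 ^ N)%N by rewrite expn_gt0.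
exists (2 ^ N).-1, T, g; split.
- move=> k j k' j' ka ka' jT jT' kk kk' jj jj'.
  pose m := (T + minn j j')%N.
  have ancg l i l' i' : (l <= (2 ^ N).-1)%N -> (l' <= (2 ^ N).-1)%N ->
      (i <= T)%N -> (i' <= T)%N -> (m <= T + i)%N -> (m <= T + i')%N ->
      (l <= l'.+1)%N -> (anc (g l i) m <= (anc (g l' i') m).+1)%N.
    move=> *; rewrite /g !anc_vtx; try lia.
    have <- : ((l' + 2 ^ (N - m)) %/ 2 ^ (N - m) = (l' %/ 2 ^ (N - m)).+1)%N.
      by rewrite divnDr // divnn expn_gt0 addn1.
    by apply: leq_div2r; lia.
  have h1 : (anc (g k j) m <= (anc (g k' j') m).+1)%N.
    by apply: ancg; rewrite /m; lia.
  have h2 : (anc (g k' j') m <= (anc (g k j) m).+1)%N.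
    by apply: ancg; rewrite /m; lia.
  have := @arc_le m (g k j) (g k' j') ltac:(rewrite lev_vtx /m; lia)
    ltac:(rewrite lev_vtx /m; lia) h1 h2.
  have : (lev (g k j) + lev (g k' j') <= 2 * m + 1)%N.
    by rewrite !lev_vtx /m; lia.
  by rewrite -(ler_nat R) !(natrM, natrD); lra.
- move=> j j' jT jT'; apply: (lt_le_trans DT).
  (* The first cell starts at 0 and the last one ends at 1, so the distance of the left ends plus
     the larger height is at least 1. *)
  have : 2 ^- 0 <= arc_radius R (g 0%N j) (g (2 ^ N).-1 j').
    have mN : (T + j' <= N)%N by lia.
    have N2 : (2 ^ N = 2 ^ (T + j') * 2 ^ (N - (T + j')))%N.
      by rewrite -expnD subnKC.
    have d0 : (0 < 2 ^ (N - (T + j')))%N by rewrite expn_gt0.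
    have e0 : idx (g 0%N j) = 0%N by rewrite /g div0n idx_vtx // expn_gt0.
    have e1 : (2 ^ (T + j') <= (idx (g (2 ^ N).-1 j')).+1)%N.
      rewrite /g idx_vtx; last by rewrite ltn_divLR // -N2; lia.
      suff : ((2 ^ (T + j')).-1 <= (2 ^ N).-1 %/ 2 ^ (N - (T + j')))%N by lia.
      by rewrite leq_divRL // N2 -subn1 mulnBl mul1n -subn1 leq_sub2l.
    have u0 : 0 < 2 ^+ (T + j') :> R by rewrite exprn_gt0.
    rewrite expr0 invr1 /= /arc_rad {1}/pos e0 mul0r sub0r normrN.
    have : 2 ^- (T + j') <= 2 ^- minn (T + j) (T + j') :> R.
      by rewrite lef_pV2 ?posrE ?exprn_gt0 // ler_weXn2l ?ler1n // geq_minr.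
    have := ler_norm (pos R (g (2 ^ N).-1 j')).
    have : 1 <= pos R (g (2 ^ N).-1 j') + 2 ^- (T + j').
      rewrite /pos lev_vtx -[X in _ + X]mul1r -mulrDl ler_pdivlMr // mul1r.
      by rewrite natr1 -natrX ler_nat.
    by rewrite !lev_vtx; lra.
  move/cone_ge; rewrite !lev_vtx !natrD.
  have := ler0n R T; have := ler0n R j; have := ler0n R j'; lra.
- move=> k k' ka ka'; apply: (lt_le_trans DT).
  have := cone_lev (g k' 0%N) (g k T).
  by rewrite metric_sym !lev_vtx !natrD; lra.
Qed.

(** * The map from the tree to the arc cone *)

Definition tree_to_arc (p : X) : Y := p.

Lemma tree_to_arc_lipschitz : large_scale_lipschitz tree_to_arc.
Proof.
exists 1, 4; split=> // p q; have [np nq pq] := lcaP p q.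
have := @arc_le (lca p q) p q np nq ltac:(by rewrite pq) ltac:(by rewrite pq).
by rewrite mul1r mdist_treeE /tree_to_arc; lra.
Qed.

(** Otherwise some distance would lie strictly between 0 and 1. *)
Lemma tree_geodesic M (gamma : R -> X) : geodesic M gamma -> M = 0.
Proof.
move=> [M0 gM]; apply/eqP; rewrite eq_le M0 andbT leNgt; apply/negP => Mgt0.
pose s := Num.min M 2^-1.
have s0 : 0 < s by rewrite lt_min Mgt0 invr_gt0 ltr0n.
have sM : s <= M by rewrite ge_min lexx.
have s1 : s < 1 by rewrite gt_min invf_lt1 ?ltr1n ?orbT ?ltr0n.
have := gM s 0; rewrite !in_itv /= M0 lexx sM (ltW s0) => /(_ isT isT).
rewrite subr0 ger0_norm ?(ltW s0) // mdist_treeE.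
move: (lev _) (lev _) (lca _ _) => a b c e.
have h1 : (2 * c < a + b)%N by rewrite -(ltr_nat R) natrM natrD; lra.
have : (a + b < 2 * c + 1)%N by rewrite -(ltr_nat R) !(natrM, natrD); lra.
by lia.
Qed.

Lemma tree_to_arc_radial : radial tree_to_arc.
Proof.
exists (vtx 0 0); split; first exact: tree_to_arc_lipschitz.
exists 1, 1; split=> // M gamma gg _ x y [s + <-] [t + <-].
rewrite (tree_geodesic gg) /= !in_itv /= => s0 t0.
have -> : s = t by lra.
by rewrite !mdistxx; lra.
Qed.

Lemma tree_to_arc_coarse : coarse tree_to_arc.
Proof.
split=> [r|A].
  exists (r + 4) => p q pq; have [np nq e] := lcaP p q.
  have := @arc_le (lca p q) p q np nq ltac:(by rewrite e) ltac:(by rewrite e).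
  by rewrite mdist_treeE in pq; rewrite /tree_to_arc; lra.
rewrite /metric_bounded => Afin.
have [D AD] : exists D : R, (diam A <= D%:E)%E.
  by case: (diam A) Afin => [d| |] // _; [exists d | exists 0; rewrite leNye].
have [D0 Ad] := (diam_leP A D).1 AD.
have [->|/set0P[x0 Ax0]] := eqVneq A set0.
  by apply: le_lt_trans (ltry 0); apply/diam_leP.
(* Levels in [A] are at most [lev x0 + D], and a path through the root has length the sum of the
   levels. *)
apply: (le_lt_trans _ (ltry (2 * ((lev x0)%:R + D)))); apply/diam_leP.
split=> [|p q Ap Aq]; first by rewrite mulr_ge0 // addr_ge0.
have := Ad _ _ Ax0 Ap; have := Ad _ _ Ax0 Aq.
have := cone_lev (x0 : Y) p; have := cone_lev (x0 : Y) q.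
by have := tree_le_lev p q; rewrite /tree_to_arc; lra.
Qed.

Lemma tree_to_arc_2to1 : coarsely_to1 2 tree_to_arc.
Proof.
split; first exact: tree_to_arc_coarse.
move=> r; have [K K0 rK] := natr_gt r.
exists (6 * K%:R + 1) => A Ar.
have Ad (p q : Y) : A p -> A q -> mdist p q < K%:R.
  move=> Ap Aq; apply: lt_trans rK; rewrite -lte_fin.
  exact: le_lt_trans (diam_ge (lexx _) Ap Aq) Ar.
have [->|/set0P[x0 Ax0]] := eqVneq A set0.
  exists (fun=> set0); split; first by rewrite bigcup0.
  move=> i; apply: (@le_lt_trans _ _ 0%:E).
    by apply/diam_leP.
  by rewrite lte_fin; have := ler0n R K; lra.
(* Levels in [A] differ from [lev x0] by at most [K]; points of [A] with distinct nonadjacent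
   ancestors at level [n] would be at distance at least [2 * K]. *)
pose n := (lev x0 - 2 * K)%N.
have levA (p : Y) : A p -> (lev p <= lev x0 + K /\ lev x0 <= lev p + K)%N.
  move=> Ap; have := Ad _ _ Ax0 Ap; rewrite -!(ler_nat R) !natrD.
  have := cone_lev x0 p; have := cone_lev p x0; rewrite (metric_sym p); lra.
have ancA (p q : Y) : A p -> A q -> (anc p n <= (anc q n).+1)%N.
  move=> Ap Aq; rewrite leqNgt; apply/negP => pq.
  have n0 : (0 < n)%N.
    by rewrite lt0n; apply: contraTneq pq => ->; rewrite !anc0.
  have := arc_ge pq; have := Ad _ _ Aq Ap.
  have [_ lp] := levA _ Ap; have [_ lq] := levA _ Aq.
  have : (2 * n + 2 * K <= lev q + lev p)%N by lia.
  have : 0 < K%:R :> R by rewrite ltr0n.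
  by rewrite -(ler_nat R) !(natrM, natrD); lra.
(* Parity tells apart the at most two adjacent ancestors of points of [A]. *)
exists (fun i : 'I_2 => [set p | A p /\ (anc p n %% 2 = i)%N]); split.
  apply/seteqP; split=> p; last by case=> i _ [].
  move=> Ap; exists (inord (anc p n %% 2)) => //.
  by rewrite /= inordK // ltn_mod.
move=> i; apply: (@le_lt_trans _ _ (6 * K%:R)%:E); last by rewrite lte_fin; lra.
apply/diam_leP; split=> [|p q [Ap pi] [Aq qi]]; first by rewrite mulr_ge0.
have [lp lp'] := levA _ Ap; have [lq lq'] := levA _ Aq.
have := ancA _ _ Ap Aq; have := ancA _ _ Aq Ap => h1 h2.
have := @tree_le n p q ltac:(lia) ltac:(lia) ltac:(lia).
have : (lev p + lev q <= 2 * n + 6 * K)%N by lia.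
by rewrite -(ler_nat R) !(natrM, natrD); lra.
Qed.

End TreeAndArc.

Theorem corollary9p5 (R : realType) :
  exists (X Y : metricType R) (f : X -> Y),
    [/\ (proper_space X /\ hyperbolic X),
        (proper_space Y /\ hyperbolic Y),
        (radial f /\ coarsely_to1 2 f),
        asdim X = (1%:R)%:E
      & asdim Y = (2%:R)%:E].
Proof.
exists (cone (tree_radius R)), (cone (arc_radius R)), (@tree_to_arc R); split.
- by split; [exact: proper_cone | exact: hyperbolic_cone].
- by split; [exact: proper_cone | exact: hyperbolic_cone].
- by split; [exact: tree_to_arc_radial | exact: tree_to_arc_2to1].
- exact: asdim_eq (@asdim_tree_le1 R) (@asdim_tree_gt0 R).
- exact: asdim_eq (@asdim_arc_le2 R) (@asdim_arc_gt1 R).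
Qed.
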